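(* Let $(X,\operatorname{dist})$ be a compact metric space and let $f\colon X\to X$ be a continuous open map with $f(X)=X$. If $f$ is positive expansive, then $f$ is positive dw-expansive with central dimension $D$ for every integer $D\geq 0$.
   Context: $f$ is positive expansive if there is $c>0$ such that if $x\neq y$ then there is $n\geq 0$ with $\operatorname{dist}(f^n(x),f^n(y))>c$. Let $\tau$ be the topology of $X$. For $\mathcal{U}\subset\tau$, write $\operatorname{ord}\mathcal{U}\leq n$ if for all $\mathcal{V}\subset\mathcal{U}$ with $|\mathcal{V}|>n+1$ one has $\bigcap\mathcal{V}=\emptyset$; $\operatorname{ord}\mathcal{U}=n$ if $\operatorname{ord}\mathcal{U}\leq n$ but not $\operatorname{ord}\mathcal{U}\leq n-1$. Let $\operatorname{mesh}(\mathcal{U})=\sup_{U\in\mathcal{U}}\operatorname{diam}(U)$. For $\epsilon>0$ and $Y\subset X$ compact define $$\dim_\epsilon Y=\inf\{\operatorname{ord}\mathcal{U}:\mathcal{U}\subset\tau,\ Y\subset\bigcup\mathcal{U},\ \operatorname{mesh}(\mathcal{U})<\epsilon\},$$ and $\dim Y=\lim_{\epsilon\to0}\dim_\epsilon Y$ (this is the usual topological dimension). $f$ is positive dw-expansive with central dimension $D$ if there is $\sigma>0$ such that if $C\subset X$ is compact with $\dim(C)>D$ then there is $n\geq 0$ such that $\dim_\sigma(f^n(C))>D$. *)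

(* Defs.v *)
From mathcomp Require Import all_boot all_order all_algebra.
From mathcomp Require Import all_classical all_reals all_analysis.

Set Implicit Arguments.
Unset Strict Implicit.
Unset Printing Implicit Defensive.

Import Order.TTheory GRing.Theory Num.Theory.
Import numFieldNormedType.Exports.

Local Open Scope classical_set_scope.
Local Open Scope card_scope.
Local Open Scope ring_scope.

(* |V| > k; an infinite V satisfies it for every k. *)
Definition card_gt (T : Type) (V : set T) (k : int) : Prop :=
  exists2 m : nat, k < m%:Z & `I_m #<= V.

Definition ord_le (T : Type) (U : set (set T)) (n : int) : Prop :=
  forall V : set (set T), V `<=` U -> card_gt V (n + 1) ->
    \bigcap_(W in V) W = set0.

(* The least n such that ord U <= n (see ord_eqP), and +oo if there is none.
   For n = -2 the only V that matters is the empty family, whose intersection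
   is the whole space: hence ord U >= -1 unless T is empty. *)
Definition ord (R : realType) (T : Type) (U : set (set T)) : \bar R :=
  ereal_inf [set (n%:~R)%:E | n in [set n : int | ord_le U n]].

Lemma ord_eqP (R : realType) (T : Type) (U : set (set T)) (n : int) :
  ord R U = (n%:~R)%:E <-> ord_le U n /\ ~ ord_le U (n - 1).
Proof.
have mono (k l : int) : k <= l -> ord_le U k -> ord_le U l.
  move=> kl Uk V VU [m lm mV]; apply: Uk => //; exists m => //.
  by apply: le_lt_trans lm; rewrite lerD2r.
split=> [ordn|[Un Un1]]; last first.
  apply/eqP; rewrite eq_le; apply/andP; split.
    by apply: ereal_inf_lbound; exists n.
  apply: le_ereal_inf_tmp => _ [k Uk <-].
  rewrite lee_fin ler_int leNgt; apply/negP => kn; apply: Un1.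
  by apply: mono Uk; rewrite -ltzD1 subrK.
split; last first.
  move=> Un1; have : (ord R U <= ((n - 1)%:~R)%:E)%E.
    by apply: ereal_inf_lbound; exists (n - 1).
  by rewrite ordn lee_fin ler_int leNgt ltrBlDr ltrDl.
have : (ord R U < ((n + 1)%:~R)%:E)%E by rewrite ordn lte_fin ltr_int ltrDl.
move=> /ereal_inf_lt[_ [k Uk <-]]; rewrite lte_fin ltr_int ltzD1 => kn.
exact: mono Uk.
Qed.

Section metric.
Context {R : realType} {X : metricType R}.

(* The suprema of the empty set in diam and mesh are -oo rather than 0; this is
   immaterial since mesh is only compared with positive numbers. *)
Definition diam (A : set X) : \bar R :=
  ereal_sup [set (mdist p.1 p.2)%:E | p in A `*` A].

Definition mesh (U : set (set X)) : \bar R := ereal_sup [set diam A | A in U].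

Definition dim_eps (e : R) (Y : set X) : \bar R :=
  ereal_inf [set ord R U | U in [set U : set (set X) |
    [/\ U `<=` open, Y `<=` \bigcup_(A in U) A & (mesh U < e%:E)%E]]].

Definition dim (Y : set X) : \bar R := lim (dim_eps e Y @[e --> 0^'+]).

Definition positive_expansive (f : X -> X) : Prop :=
  exists2 c : R, 0 < c & forall x y : X, x <> y ->
    exists n : nat, c < mdist (iter n f x) (iter n f y).

Definition positive_dw_expansive (f : X -> X) (D : nat) : Prop :=
  exists2 s : R, 0 < s & forall C : set X, compact C ->
    ((D%:R)%:E < dim C)%E ->
    exists n : nat, ((D%:R)%:E < dim_eps s (iter n f @` C))%E.

End metric.

(* Main.v *)
Require Import Defs.
From mathcomp Require Import all_boot all_order all_algebra.
From mathcomp Require Import all_classical all_reals all_analysis.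
From mathcomp Require Import lra.

(** Let c be a constant of expansivity. Good covers of C are obtained by pulling
back, along f^n for large n, a single-scale cover of f^n(C).

By compactness of X * X, two points whose orbits stay c-close up to a large
time N are close to each other ([uniform_expansivity]). Hence there is s > 0
such that orbits that are c-close up to time n and s-close at time n are in
fact c/2-close all along ([orbit_close_shrink]). Now let A be a set of diameter
less than s. On the preimage of A under f^n the relation of having c/2-close
orbits up to time n is transitive: two steps give c-closeness, the end points
in A are s-close, and so c/2-closeness is recovered. This relation therefore
cuts the preimage into disjoint open classes ([orbit_piece]), which play the
role of the images of A under the inverse branches of f^n, and whose diameters
tend to 0 with n, uniformly in A.

Suppose that dim_s (f^n(C)) <= D for every n. Cover f^n(C) by open sets of
diameter less than s and of order at most D, and cut their preimages into
classes. Distinct classes through one point x come from distinct members of the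
cover of f^n(C), because classes of the same member are disjoint, and these
members all contain f^n(x). So the order does not increase
([orbit_pieces_ord_le]), while the mesh is as small as desired, and therefore
dim C <= D ([dim_le_orbit]). The theorem is the contrapositive. *)

Set Implicit Arguments.
Unset Strict Implicit.
Unset Printing Implicit Defensive.

Local Open Scope classical_set_scope.

Import Order.TTheory GRing.Theory Num.Theory.
Import numFieldNormedType.Exports.
Local Open Scope card_scope.
Local Open Scope ring_scope.

(** * Order of families of sets *)

Lemma ord_le_mono (T : Type) (U : set (set T)) (k l : int) :
  k <= l -> ord_le U k -> ord_le U l.
Proof.
move=> kl Uk V VU [m lm mV]; apply: Uk => //; exists m => //.
by apply: le_lt_trans lm; rewrite lerD2r.
Qed.

(** A family V does not have larger order than U when each member of V is
labelled, through h, by a member of U containing its image, and intersecting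
members with the same label coincide. For if z lies in all the members of a
subfamily of V, then labels are injective on that subfamily and h z lies in
all of them. *)
Lemma ord_le_label (S T : Type) (h : S -> T) (g : set S -> set T)
    (V : set (set S)) (U : set (set T)) (k : int) :
  (forall A, V A -> U (g A)) ->
  (forall A, V A -> A `<=` h @^-1` g A) ->
  (forall A B, V A -> V B -> g A = g B -> A `&` B !=set0 -> A = B) ->
  ord_le U k -> ord_le V k.
Proof.
move=> gU hg ginj Uk W WV [m km mW]; rewrite -subset0 => z Wz.
have inj_g : {in W &, injective g}.
  move=> A B /set_mem WA /set_mem WB gAB.
  by apply: ginj gAB _; [exact: WV|exact: WV|exists z; split; apply: Wz].
have gWU : g @` W `<=` U by move=> _ [A WA <-]; exact/gU/WV.
have mgW : card_gt (g @` W) (k + 1).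
  by exists m => //; rewrite (card_le_eqr (inj_card_eq inj_g)).
have := Uk _ gWU mgW; rewrite -subset0 => /(_ (h z)); apply.
by move=> _ [A WA <-]; apply: hg; [exact: WV|exact: Wz].
Qed.

(** * Dimension at a given scale *)

Section small_covers.
Context {R : realType} {X : metricType R}.
Implicit Types (x y : X) (Y A : set X) (U : set (set X)) (e d : R).

Lemma mdist_lt_mesh U e A x y : (mesh U < e%:E)%E -> U A -> A x -> A y ->
  mdist x y < e.
Proof.
move=> Ue UA Ax Ay; rewrite -lte_fin; apply: le_lt_trans Ue.
apply: (@le_trans _ _ (diam A)); last by apply: ereal_sup_ubound; exists A.
by apply: ereal_sup_ubound; exists (x, y).
Qed.

Lemma mesh_le U e :
  (forall A x y, U A -> A x -> A y -> mdist x y <= e) -> (mesh U <= e%:E)%E.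
Proof.
move=> Ue; apply: ge_ereal_sup => _ [A UA <-].
by apply: ge_ereal_sup => _ [[x y] [/= Ax Ay] <-]; rewrite lee_fin (Ue A).
Qed.

(** A bound on two nested infima yields an actual cover because bounds on the
order are integers: a value below D + 1 is at most D. *)
Lemma dim_eps_leP e Y (D : nat) : (dim_eps e Y <= (D%:R)%:E)%E <->
  exists U, [/\ U `<=` open, Y `<=` \bigcup_(A in U) A, (mesh U < e%:E)%E
    & ord_le U D%:Z].
Proof.
split=> [YD|[U [Uo YU Ue UD]]]; last first.
  apply: (@le_trans _ _ (ord R U)); first by apply: ereal_inf_lbound; exists U.
  by apply: ereal_inf_lbound; exists D%:Z.
have : (dim_eps e Y < ((D%:Z + 1)%:~R)%:E)%E.
  by apply: le_lt_trans YD _; rewrite lte_fin -[D%:R]/(D%:Z%:~R) ltr_int ltrDl.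
move=> /ereal_inf_lt[_ [U [Uo YU Ue] <-]] /ereal_inf_lt[_ [k Uk <-]].
rewrite lte_fin ltr_int ltzD1 => kD.
by exists U; split=> //; exact: ord_le_mono Uk.
Qed.

Lemma dim_eps_nonincreasing e d Y :
  e <= d -> (dim_eps d Y <= dim_eps e Y)%E.
Proof.
move=> ed; apply: le_ereal_inf_tmp => _ [U [Uo YU Ue] <-].
apply: ereal_inf_lbound; exists U => //; split=> //.
by apply: lt_le_trans Ue _; rewrite lee_fin.
Qed.

(** The dimension is defined with [lim], which is meaningful only for convergent
functions: convergence comes from the monotonicity of [dim_eps]. *)
Lemma dim_le Y (a : \bar R) :
  (forall e, 0 < e -> (dim_eps e Y <= a)%E) -> (Defs.dim Y <= a)%E.
Proof.
move=> Ya; apply: lime_le.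
  apply: nonincreasing_at_right_is_cvge; near=> b.
  by move=> e d _ _; exact: dim_eps_nonincreasing.
by near=> e; apply: Ya.
Unshelve. all: by end_near. Qed.

(** * Compactness arguments in the square *)

Lemma mdist_continuous : continuous (fun p : X * X => mdist p.1 p.2 : R).
Proof.
move=> [x y]; apply/cvgrPdist_lt => e e0.
have e20 : 0 < e / 2 by rewrite divr_gt0.
near=> p.
have xp : mdist x p.1 < e / 2.
  near: p; apply: (@cvg_fst _ _ (nbhs x) (nbhs y) _ [set u | mdist x u < e / 2]).
  by rewrite -ballEmdist; exact: nbhsx_ballx.
have yp : mdist y p.2 < e / 2.
  near: p; apply: (@cvg_snd _ _ (nbhs x) (nbhs y) _ [set u | mdist y u < e / 2]).
  by rewrite -ballEmdist; exact: nbhsx_ballx.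
rewrite ltr_norml/= (splitr e).
have := metric_triangle x p.1 p.2; have := metric_triangle p.1 p.2 y.
have := metric_triangle x p.1 y; have := metric_triangle p.1 x p.2.
have := metric_triangle x y p.2; rewrite (metric_sym p.2 y) (metric_sym p.1 x).
by move=> *; apply/andP; split; lra.
Unshelve. all: by end_near. Qed.

End small_covers.

Section dynamics.
Context {R : realType} {X : metricType R}.
Hypothesis X_compact : compact [set: X].
Implicit Types (x y : X) (c e : R) (n N : nat).

Let XX_near_covering : near_covering [set: X * X].
Proof.
apply/compact_near_coveringP; rewrite -setXTT.
exact: compact_setX.
Qed.

(** Every point of X * X has a neighbourhood on which the claim holds for all
small e: on the diagonal because W is open, off the diagonal because the
distance is locally bounded below. Compactness makes e uniform. *)
Lemma compact_nbhs_diagonal (W : set (X * X)) :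
  open W -> (forall x, W (x, x)) ->
  exists2 e : R, 0 < e & forall x y, mdist x y < e -> W (x, y).
Proof.
move=> Wo Wdiag.
have : \forall e \near (0 : R)^'+, [set: X * X] `<=`
    [set p | mdist p.1 p.2 < e -> W p].
  apply: XX_near_covering => -[x y] _.
  have [<-|/eqP xy] := pselect (x = y).
    near=> p e => /= _; near: p.
    exact: (open_nbhs_nbhs (conj Wo (Wdiag x))).
  have dxy : 0 < mdist x y by rewrite mdist_gt0.
  (* near (x, y) distances exceed mdist x y / 2, hence e, so the premise of the
     claim fails *)
  near=> p e => /= pe; exfalso.
  have : mdist x y / 2 < mdist p.1 p.2.
    near: p; apply: (@mdist_continuous _ _ (x, y) [set r | _ < r]).
    by apply: lt_nbhsr; rewrite /= ltr_pdivrMr// ltr_pMr// ltr1n.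
  apply/negP; rewrite -leNgt; apply: ltW; apply: lt_trans pe _.
  by near: e; apply: nbhs_right_lt; rewrite divr_gt0.
move=> We; near (0 : R)^'+ => e.
exists e => // x y xy.
suff : [set: X * X] `<=` [set p | mdist p.1 p.2 < e -> W p].
  by move=> /(_ (x, y) I); exact.
by near: e.
Unshelve. all: by end_near. Qed.

(** * Orbits of a positive expansive map *)

Context {f : X -> X}.
Hypothesis f_continuous : continuous f.

Lemma iter_continuous n : continuous (iter n f).
Proof.
elim: n => [|n IHn] x //=.
by apply: continuous_comp; [exact: IHn|exact: f_continuous].
Qed.

Definition orbit_close n c x y :=
  forall i, (i <= n)%N -> mdist (iter i f x) (iter i f y) < c.

Lemma orbit_mdist_continuous n :
  continuous (fun p : X * X => mdist (iter n f p.1) (iter n f p.2) : R).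
Proof.
move=> p; apply: (@continuous_comp _ _ _
    (fun q => (iter n f q.1, iter n f q.2)) _ p _ (@mdist_continuous _ _ _)).
apply: cvg_pair.
  exact: (@continuous_comp _ _ _ fst _ p cvg_fst (@iter_continuous n _)).
exact: (@continuous_comp _ _ _ snd _ p cvg_snd (@iter_continuous n _)).
Qed.

Lemma orbit_close_open n c : open [set p : X * X | orbit_close n c p.1 p.2].
Proof.
rewrite openE => p /= pc.
have : \forall q \near p, forall i : 'I_n.+1,
    mdist (iter i f q.1) (iter i f q.2) < c.
  apply: (@filter_forall _ 'I_n.+1 (fun i : 'I_n.+1 => [set q : X * X |
    mdist (iter i f q.1) (iter i f q.2) < c]) _ (nbhs_filter p)) => i.
  apply: (@orbit_mdist_continuous i p [set r | r < c]).
  by apply: lt_nbhsl; exact: pc (ltn_ord i).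
by apply: filterS => q qc i ni; exact: (qc (Ordinal (ni : (i < n.+1)%N))).
Qed.

Context {c : R}.
Hypothesis c_gt0 : 0 < c.
Hypothesis c_expansive : forall x y, x <> y ->
  exists n : nat, c < mdist (iter n f x) (iter n f y).

(** A pair off the diagonal is c-separated at some time n, and so are all the
pairs near it at that same time; pairs near the diagonal are e-close anyway.
Compactness of X * X gives one N for all pairs. *)
Lemma uniform_expansivity e : 0 < e ->
  exists N, forall x y, orbit_close N c x y -> mdist x y < e.
Proof.
move=> e0.
have : \forall N \near \oo, [set: X * X] `<=`
    [set p | orbit_close N c p.1 p.2 -> mdist p.1 p.2 < e].
  apply: XX_near_covering => -[x y] _.
  have [<-|/c_expansive[n cn]] := pselect (x = y).
    near=> p N => /= _; near: p.
    apply: (@mdist_continuous _ _ (x, x) [set r | r < e]).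
    by apply: lt_nbhsl; rewrite /= mdistxx.
  near=> p N => /= pN; exfalso.
  have : c < mdist (iter n f p.1) (iter n f p.2).
    near: p; apply: (@orbit_mdist_continuous n (x, y) [set r | c < r]).
    exact: lt_nbhsr.
  apply/negP; rewrite -leNgt; apply/ltW/pN.
  by near: N; exact: nbhs_infty_ge.
move=> [N _ NE]; exists N => x y; exact: (NE N (leqnn N) (x, y)).
Unshelve. all: by end_near. Qed.

Lemma orbit_close_half n x y z :
  orbit_close n (c / 2) x y -> orbit_close n (c / 2) x z -> orbit_close n c y z.
Proof.
move=> xy xz i ni; rewrite (splitr c).
apply: le_lt_trans (metric_triangle _ (iter i f x) _) _.
by rewrite ltrD ?xz// metric_sym xy.
Qed.

(** With N the time at which c-closeness forces c/2-closeness, s is chosen so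
that s-close points stay c-close for N more steps. Then at each i <= n the
orbits are c-close from time i up to time i + N. *)
Lemma orbit_close_shrink : exists2 s : R, 0 < s & forall n x y,
  orbit_close n c x y -> mdist (iter n f x) (iter n f y) < s ->
  orbit_close n (c / 2) x y.
Proof.
have [N NE] := uniform_expansivity (divr_gt0 c_gt0 (ltr0Sn R 1)).
have [x i _|s s0 sE] := compact_nbhs_diagonal (@orbit_close_open N c).
  by rewrite /= mdistxx.
exists s => // n x y nc ns i ni; apply: NE => j jN; rewrite -!iterD.
have [jn|/ltnW nj] := leqP (j + i) n; first exact: nc.
rewrite -(subnK nj) !iterD; apply: (sE _ _ ns).
by rewrite leq_subLR (leq_trans (leq_add jN ni))// addnC.
Qed.

(** * Pulling back covers *)

(** A substitute for the image of A under the inverse branch of f^n through x,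
defined without constructing inverse branches. *)
Definition orbit_piece n (A : set X) x :=
  [set y | A (iter n f y) /\ orbit_close n (c / 2) x y].

Lemma orbit_piece_open n A x : open A -> open (orbit_piece n A x).
Proof.
move=> Ao; apply: openI.
  by apply: open_comp Ao => y _; exact: iter_continuous.
apply: (open_comp (f := fun y => (x, y)) _ (@orbit_close_open n (c / 2))).
by move=> y _; apply: cvg_pair; [exact: cvg_cst|exact: cvg_id].
Qed.

Variable s : R.
Hypothesis sP : forall n x y,
  orbit_close n c x y -> mdist (iter n f x) (iter n f y) < s ->
  orbit_close n (c / 2) x y.

(** Transitivity of c/2-closeness on the preimage of A: each composition of two
c/2-close steps is c-close, and shrinks back to c/2-close as both points end
in A. *)
Lemma orbit_piece_eq n A x y :
  (forall u v, A u -> A v -> mdist u v < s) ->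
  A (iter n f x) -> A (iter n f y) ->
  orbit_piece n A x `&` orbit_piece n A y !=set0 ->
  orbit_piece n A x = orbit_piece n A y.
Proof.
move=> As Ax Ay [z [xz yz]].
have piece_sub a b : A (iter n f b) ->
    orbit_piece n A a z -> orbit_piece n A b z ->
    orbit_piece n A a `<=` orbit_piece n A b.
  move=> Ab [Az az] [_ bz] w [Aw aw]; split=> //.
  (* z and w are compared through a, and then b and w through z *)
  have zw : orbit_close n (c / 2) z w.
    by apply: sP (As _ _ Az Aw); exact: orbit_close_half aw.
  have zb : orbit_close n (c / 2) z b.
    by move=> i ni; rewrite metric_sym bz.
  by apply: sP (As _ _ Ab Aw); exact: orbit_close_half zw.
by apply/seteqP; split; apply: piece_sub.
Qed.

Definition orbit_pieces n (U : set (set X)) : set (set X) :=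
  [set B | exists A x, [/\ U A, A (iter n f x) & B = orbit_piece n A x]].

(** The label of a piece is a member of U from which it is cut, so that
[ord_le_label] applies along f^n. *)
Lemma orbit_pieces_ord_le n (U : set (set X)) k :
  (mesh U < s%:E)%E -> ord_le U k -> ord_le (orbit_pieces n U) k.
Proof.
move=> Us.
have /choice[g gP] : forall B, exists A, orbit_pieces n U B ->
    U A /\ exists2 x, A (iter n f x) & B = orbit_piece n A x.
  move=> B; have [[A [x [UA Ax BE]]]|nB] := pselect (orbit_pieces n U B).
    by exists A => _; split=> //; exists x.
  by exists set0.
apply: (ord_le_label (h := iter n f) (g := g)).
- by move=> B /gP[].
- by move=> B /gP[_ [x _ BE]] y; rewrite {1}BE => -[].
move=> B B' /gP[UB [x Bx BE]] /gP[_ [x' Bx' BE']] gBB'; move: Bx' BE'.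
rewrite -gBB' => Bx' BE'; rewrite BE BE'; apply: orbit_piece_eq => // u v.
exact: mdist_lt_mesh Us UB.
Qed.

Lemma dim_le_orbit (C : set X) (D : nat) :
  (forall n, dim_eps s (iter n f @` C) <= (D%:R)%:E)%E ->
  (Defs.dim C <= (D%:R)%:E)%E.
Proof.
move=> CD; apply: dim_le => e e0.
have [n nE] := uniform_expansivity (divr_gt0 e0 (ltr0Sn R 1)).
have /dim_eps_leP[U [Uo CU Us UD]] := CD n.
apply/dim_eps_leP; exists (orbit_pieces n U); split.
- by move=> _ [A [x [UA _ ->]]]; exact/orbit_piece_open/Uo.
- move=> x Cx; have [A UA Ax] := CU _ (imageP (iter n f) Cx).
  exists (orbit_piece n A x); first by exists A, x.
  by split=> // i _; rewrite mdistxx divr_gt0.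
- apply: (@le_lt_trans _ _ (e / 2)%:E); last first.
    by rewrite lte_fin ltr_pdivrMr// ltr_pMr// ltr1n.
  apply: mesh_le => _ y z [A [x [_ _ ->]]] [_ xy] [_ xz].
  exact/ltW/nE/(orbit_close_half xy xz).
- exact: orbit_pieces_ord_le.
Qed.

End dynamics.

Theorem proposition2p18 (R : realType) (X : metricType R) (f : X -> X)
    (X_compact : compact [set: X])
    (f_continuous : continuous f)
    (f_open : forall U : set X, open U -> open (f @` U))
    (f_surj : f @` [set: X] = [set: X])
    (f_exp : positive_expansive f) (D : nat) :
  positive_dw_expansive f D.
Proof.
have [c c0 cE] := f_exp.
have [s s0 sE] := orbit_close_shrink X_compact f_continuous c0 cE.
exists s => // C _ DC; apply: contrapT => /forallNP CD.
move: DC; apply/negP; rewrite -leNgt.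
apply: (dim_le_orbit X_compact f_continuous c0 cE sE) => n.
by rewrite leNgt; apply/negP/CD.
Qed.
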